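(* Let $n\ge1$, $0<m\le L$, $\kappa=L/m$, and let $(\alpha,\beta,\gamma)$ be constant parameters such that the two-step momentum algorithm converges linearly with rate $\rho=1-1/T_s\in(0,1)$ for all $f\in\mathcal{Q}_m^L$. Then $$J_{\max}\,T_s\ge\sigma_w^2\Big((n-1)\frac{\kappa^2}{64}+\frac{\sqrt\kappa+1}{2}\Big),\qquad J_{\min}\,T_s\ge\sigma_w^2\Big(\frac{\kappa^2}{64}+(n-1)\frac{\sqrt\kappa+1}{2}\Big).$$ Furthermore, for the gradient noise model ($\sigma_w=\alpha\sigma$), $$J_{\max}\,T_s\ge\frac{\sigma^2}{L^2}\Big((n-1)\frac{\kappa^2}{4}+\max\Big\{\frac{\kappa^2}{T_s^3},\frac14\Big\}\Big),\qquad J_{\min}\,T_s\ge\frac{\sigma^2}{L^2}\Big(\frac{\kappa^2}{4}+(n-1)\max\Big\{\frac{\kappa^2}{T_s^3},\frac14\Big\}\Big).$$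
   Context: $\mathcal{Q}_m^L$ is the class of quadratic functions $f(x)=\tfrac12x^TQx-q^Tx$ on $\mathbb{R}^n$ with $q\in\mathbb{R}^n$, $Q=Q^T\succ0$ whose largest eigenvalue is $L$ and smallest is $m$; $x^\star$ is the minimizer. The noisy two-step momentum algorithm with constant parameters $(\alpha,\beta,\gamma)$ is $x^{t+2}=x^{t+1}+\beta(x^{t+1}-x^t)-\alpha\nabla f\big(x^{t+1}+\gamma(x^{t+1}-x^t)\big)+\sigma_w w^t$, where $w^t$ is white noise with $\mathbb{E}[w^t]=0$, $\mathbb{E}[w^t(w^\tau)^T]=I\,\delta(t-\tau)$. In the iterate noise model $\sigma_w=\sigma$, in the gradient noise model $\sigma_w=\alpha\sigma$, with $\sigma>0$. With $\psi^t=[(x^t-x^\star)^T,(x^{t+1}-x^\star)^T]^T$, $\psi^{t+1}=A\psi^t+Bw^t$, $A=\begin{bmatrix}0&I\\-\beta I+\gamma\alpha Q&(1+\beta)I-(1+\gamma)\alpha Q\end{bmatrix}$, $B^T=[0\;\;\sigma_wI]$. The algorithm converges linearly with rate $\rho$ for all $f\in\mathcal{Q}_m^L$ if the spectral radius of $A$ is at most $\rho$ for every $f\in\mathcal{Q}_m^L$. Settling time $T_s=1/(1-\rho)$. Noise amplification $J=\lim_{t\to\infty}\frac1t\sum_{k=0}^t\mathbb{E}\|x^k-x^\star\|_2^2$ (depends on $f$); $J_{\max}=\max_{f\in\mathcal{Q}_m^L}J$, $J_{\min}=\min_{f\in\mathcal{Q}_m^L}J$.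
   Formalization: The case n=1 with m<L is excluded: a 1×1 matrix has only one eigenvalue, so the class Q_m^L is then empty and J_max, J_min are undefined; the theorem is stated for n≥2, or m=L. *)

(* Defs.v *)
From HB Require Import structures.
From mathcomp Require Import all_boot all_order all_algebra.
From mathcomp Require Import all_classical all_reals all_analysis.
From mathcomp Require Import complex.
Set Implicit Arguments. Unset Strict Implicit. Unset Printing Implicit Defensive.
Import Order.TTheory GRing.Theory Num.Theory.
Local Open Scope ring_scope.

Section MomentumDefs.
Context {R : realType} {n : nat}.

Definition sqnorm (v : 'cV[R]_n) : R := \sum_(i < n) (v i ord0) ^+ 2.

Definition quad (Q : 'M[R]_n) (q : 'cV[R]_n) (y : 'cV[R]_n) : R :=
  2^-1 * (y^T *m Q *m y) 0 0 - (q^T *m y) 0 0.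

(** gradient of [quad Q q] when Q is symmetric *)
Definition grad_quad (Q : 'M[R]_n) (q : 'cV[R]_n) (y : 'cV[R]_n) : 'cV[R]_n :=
  Q *m y - q.

Definition in_QmL (m L : R) (Q : 'M[R]_n) : Prop :=
  [/\ Q^T = Q,
      (forall v : 'cV[R]_n, v != 0 -> 0 < (v^T *m Q *m v) 0 0),
      eigenvalue Q L /\ (forall lam, eigenvalue Q lam -> lam <= L) &
      eigenvalue Q m /\ (forall lam, eigenvalue Q lam -> m <= lam)].

Definition is_minimizer (Q : 'M[R]_n) (q : 'cV[R]_n) (xs : 'cV[R]_n) : Prop :=
  forall y, quad Q q xs <= quad Q q y.

Definition momentum_step (alpha beta gamma sigw : R) (Q : 'M[R]_n) (q : 'cV[R]_n)
    (wt : 'cV[R]_n) (p : 'cV[R]_n * 'cV[R]_n) : 'cV[R]_n * 'cV[R]_n :=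
  let: (xt, xt1) := p in
  (xt1, xt1 + beta *: (xt1 - xt)
            - alpha *: grad_quad Q q (xt1 + gamma *: (xt1 - xt)) + sigw *: wt).

(** [iterates ... t] = (x^t, x^{t+1}) for the noise realization [e] *)
Fixpoint iterates (alpha beta gamma sigw : R) (Q : 'M[R]_n) (q : 'cV[R]_n)
    (x0 x1 : 'cV[R]_n) (e : nat -> 'cV[R]_n) (t : nat) : 'cV[R]_n * 'cV[R]_n :=
  match t with
  | 0 => (x0, x1)
  | t'.+1 => momentum_step alpha beta gamma sigw Q q (e t')
               (iterates alpha beta gamma sigw Q q x0 x1 e t')
  end.

(** The state matrix A of psi^{t+1} = A psi^t + B w^t *)
Definition momentum_matrix (alpha beta gamma : R) (Q : 'M[R]_n) : 'M[R]_(n + n) :=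
  block_mx 0 1%:M
           ((- beta)%:M + (gamma * alpha) *: Q)
           ((1 + beta)%:M - ((1 + gamma) * alpha) *: Q).

End MomentumDefs.

Definition spectral_radius_le {R : realType} {k : nat} (A : 'M[R]_k) (rho : R) : Prop :=
  forall lam : R[i], eigenvalue (map_mx (fun x : R => x%:C%C) A) lam ->
    (`|lam| <= rho%:C)%C.

Definition converges_linearly {R : realType} (n : nat) (m L alpha beta gamma rho : R) : Prop :=
  forall Q : 'M[R]_n, in_QmL m L Q ->
    spectral_radius_le (momentum_matrix alpha beta gamma Q) rho.

Section Noise.
Context {R : realType} {d : measure_display} {Omega : measurableType d}
        (P : probability Omega R) {n : nat}.

Local Open Scope ereal_scope.

Definition white_noise (w : nat -> Omega -> 'cV[R]_n) : Prop :=
  [/\ (forall t (i : 'I_n), measurable_fun setT (fun om => w t om i ord0)),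
      (forall t (i : 'I_n), \int[P]_om (w t om i ord0)%:E = 0) &
      (forall t s (i j : 'I_n),
         \int[P]_om (w t om i ord0 * w s om j ord0)%:E
           = (if (t == s) && (i == j) then 1 else 0)%:E)].

Definition msd (w : nat -> Omega -> 'cV[R]_n) (x0 x1 : 'cV[R]_n)
    (alpha beta gamma sigw : R) (Q : 'M[R]_n) (q xs : 'cV[R]_n) (k : nat) : \bar R :=
  \int[P]_om (sqnorm
     ((iterates alpha beta gamma sigw Q q x0 x1 (fun t => w t om) k).1 - xs))%:E.

Definition noise_amp (w : nat -> Omega -> 'cV[R]_n) (x0 x1 : 'cV[R]_n)
    (alpha beta gamma sigw : R) (Q : 'M[R]_n) (q xs : 'cV[R]_n) : \bar R :=
  limn (fun t : nat => ((t%:R)^-1)%:E *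
          \sum_(0 <= k < t.+1) msd w x0 x1 alpha beta gamma sigw Q q xs k).

Definition J_values (w : nat -> Omega -> 'cV[R]_n) (x0 x1 : 'cV[R]_n)
    (m L alpha beta gamma sigw : R) : set (\bar R) :=
  [set y | exists (Q : 'M[R]_n) (q xs : 'cV[R]_n),
     [/\ in_QmL m L Q, is_minimizer Q q xs &
         y = noise_amp w x0 x1 alpha beta gamma sigw Q q xs]].

Definition J_max w x0 x1 m L alpha beta gamma sigw :=
  ereal_sup (J_values w x0 x1 m L alpha beta gamma sigw).
Definition J_min w x0 x1 m L alpha beta gamma sigw :=
  ereal_inf (J_values w x0 x1 m L alpha beta gamma sigw).

End Noise.

(* Main.v *)
(** The error [x^t - x*] splits into a noise-free response, which dies out, and
    the responses [U_j(Q) w_s] to past noise, where the matrices [U_j(Q)] are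
    polynomials in [Q] solving the second-order recurrence of the algorithm.
    White noise makes these orthogonal, so the mean square error is a sum of
    traces [tr U_j(Q)^2 = sum_i U_j(lam_i)^2] over the eigenvalues of [Q], and a
    Lyapunov function of the scalar recurrence sums the series over [j]:
    [J = sigw^2 * sum_i (1 + p_i) / ((1 - p_i) ((1 + p_i)^2 - s_i^2))], with
    [z^2 - s_i z + p_i] the characteristic polynomial of the mode [lam_i].

    Convergence with rate [rho] confines [(s_i, p_i)] to a triangle, on which
    [d_i = 1 - s_i + p_i = alpha * lam_i] lies in
    [[(1 - rho)^2, (1 + rho)^2]] and each mode satisfies
    [J_i >= sigw^2] and [J_i * Ts >= sigw^2 / (4 d_i^2)].  Comparing [d] at
    [lam = m] and [lam = L] gives all four bounds. *)
Require Import Defs.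
From HB Require Import structures.
From mathcomp Require Import all_boot all_order all_algebra.
From mathcomp Require Import all_classical all_reals all_analysis.
From mathcomp Require Import measurable_realfun.
From mathcomp Require Import complex.
From mathcomp Require Import ring lra zify.
Set Implicit Arguments. Unset Strict Implicit. Unset Printing Implicit Defensive.
Import Order.TTheory GRing.Theory Num.Theory.
Import numFieldNormedType.Exports.
Local Open Scope ring_scope.

(** * Second-order linear recurrences and the energy of their responses *)

Section SecondOrderRecurrence.

(** Stated over any ring so that the recurrence can run on polynomials and then be evaluated at an
    eigenvalue. *)
Definition lrec (A : pzRingType) (s p u0 u1 : A) (k : nat) : A :=
  (iter k (fun u => (u.2, s * u.2 - p * u.1)) (u0, u1)).1.

Lemma lrecSS (A : pzRingType) (s p u0 u1 : A) k :
  lrec s p u0 u1 k.+2 = s * lrec s p u0 u1 k.+1 - p * lrec s p u0 u1 k.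
Proof. by []. Qed.

Lemma nat_ind2 (P : nat -> Prop) :
  P 0 -> P 1 -> (forall k, P k -> P k.+1 -> P k.+2) -> forall k, P k.
Proof.
move=> P0 P1 PS k; suff [] : P k /\ P k.+1 by [].
by elim: k => [|k [Pk PSk]]; split=> //; apply: PS.
Qed.

Lemma rmorph_lrec (A B : pzRingType) (f : {rmorphism A -> B}) s p u0 u1 k :
  f (lrec s p u0 u1 k) = lrec (f s) (f p) (f u0) (f u1) k.
Proof.
elim/nat_ind2: k => // k IH0 IH1.
by rewrite !lrecSS rmorphB !rmorphM IH0 IH1.
Qed.

Variable R : realType.
Implicit Types s p u v : R.

(** The energy of the impulse response [0, 1, s, ...], as [cvg_series_impulse] confirms. *)
Definition gain s p : R := (1 + p) / ((1 - p) * ((1 + p) ^+ 2 - s ^+ 2)).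

(** The Jury conditions: both roots of [z ^+ 2 - s * z + p] lie in the open unit disc. *)
Definition stable s p := [/\ p < 1, 0 < 1 + s + p & 0 < 1 - s + p].

(* The quadratic form solving the discrete Lyapunov equation of the
   recurrence with the square of the current term as stage cost. *)
Definition lyapunov s p u v : R :=
  u ^+ 2 + gain s p * ((p * u) ^+ 2 - 2 * s * p / (1 + p) * u * v + v ^+ 2).

Lemma gain_ge0 s p : stable s p -> 0 <= gain s p.
Proof.
move=> [p1 sp sm]; apply: divr_ge0; first lra.
by apply: mulr_ge0; first lra; nra.
Qed.

(** With [t = s / (1 + p)], stability gives [t ^+ 2 <= 1], and completing the square in [v] leaves a
    nonnegative remainder. *)
Lemma lyapunov_ge0 s p u v : stable s p -> 0 <= lyapunov s p u v.
Proof.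
move=> sta; have g0 := gain_ge0 sta; case: sta => p1 sp sm.
have p0 : 0 < 1 + p by lra.
apply: addr_ge0; first exact: sqr_ge0.
apply: mulr_ge0 => //.
set t := s / (1 + p).
have -> : 2 * s * p / (1 + p) = 2 * p * t by rewrite /t; field; lra.
have t1 : t ^+ 2 <= 1.
  rewrite /t expr_div_n ler_pdivrMr ?exprn_gt0// mul1r; nra.
have -> : (p * u) ^+ 2 - 2 * p * t * u * v + v ^+ 2 =
  (v - t * (p * u)) ^+ 2 + (p * u) ^+ 2 * (1 - t ^+ 2) by ring.
by rewrite addr_ge0 ?sqr_ge0// mulr_ge0 ?sqr_ge0 ?subr_ge0.
Qed.

Lemma lyapunov_step s p u v : stable s p ->
  lyapunov s p v (s * v - p * u) = lyapunov s p u v - u ^+ 2.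
Proof.
move=> [p1 sp sm]; rewrite /lyapunov /gain; field.
apply/and3P; split; apply: lt0r_neq0; first [lra | nra].
Qed.

Lemma sum_sqr_lrec s p u0 u1 N : stable s p ->
  \sum_(0 <= k < N) lrec s p u0 u1 k ^+ 2 =
  lyapunov s p u0 u1 - lyapunov s p (lrec s p u0 u1 N) (lrec s p u0 u1 N.+1).
Proof.
move=> sta; elim: N => [|N IH]; first by rewrite big_nil /lrec/= subrr.
by rewrite big_nat_recr//= IH lrecSS lyapunov_step//; ring.
Qed.

Local Open Scope classical_set_scope.

(** By telescoping, the partial sums stay below the initial value of the Lyapunov function; no
    formula for the roots is involved. *)
Lemma is_cvg_series_sqr_lrec s p u0 u1 : stable s p ->
  cvgn (series (fun k => lrec s p u0 u1 k ^+ 2)).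
Proof.
move=> sta; apply: nondecreasing_is_cvgn.
  by apply: nondecreasing_series => *; apply: sqr_ge0.
exists (lyapunov s p u0 u1) => _ [N _ <-].
by rewrite /series/= sum_sqr_lrec// lerBlDr lerDl lyapunov_ge0.
Qed.

Lemma cvg_lrec s p u0 u1 : stable s p -> lrec s p u0 u1 k @[k --> \oo] --> 0.
Proof.
move=> sta; have u2c := cvg_series_cvg_0 (is_cvg_series_sqr_lrec (u0 := u0) (u1 := u1) sta).
apply/norm_cvg0P; rewrite -[X in _ --> X]sqrtr0.
under eq_fun do rewrite -sqrtr_sqr.
by apply: continuous_cvg => //; exact: sqrt_continuous.
Qed.

(** In the telescoped sum the final Lyapunov value vanishes in the limit, since both of its
    arguments tend to zero. *)
Lemma cvg_series_sqr_lrec s p u0 u1 : stable s p ->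
  series (fun k => lrec s p u0 u1 k ^+ 2) @ \oo --> lyapunov s p u0 u1.
Proof.
move=> sta; have u0c := cvg_lrec u0 u1 sta.
have u1c : lrec s p u0 u1 k.+1 @[k --> \oo] --> 0.
  by move: u0c; rewrite -cvg_shiftS.
rewrite -[X in _ --> X]subr0.
under [X in X @ _]eq_fun do rewrite /series/= sum_sqr_lrec//.
apply: cvgB; first exact: cvg_cst.
rewrite /lyapunov /=.
have -> : 0 = 0 ^+ 2 + gain s p * ((p * 0) ^+ 2 - 2 * s * p / (1 + p) * 0 * 0 + 0 ^+ 2) :> R.
  by ring.
apply: cvgD; first by rewrite expr2; apply: cvgM.
apply: cvgM; first exact: cvg_cst.
apply: cvgD; last by apply: cvgM.
apply: cvgB; first by apply: cvgM; apply: cvgM => //; apply: cvg_cst.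
by apply: cvgM => //; apply: cvgM => //; apply: cvg_cst.
Qed.

Lemma cvg_series_impulse s p : stable s p ->
  series (fun k => lrec s p 0 1 k ^+ 2) @ \oo --> gain s p.
Proof.
move=> sta; suff <- : lyapunov s p 0 1 = gain s p by exact: cvg_series_sqr_lrec.
by rewrite /lyapunov; ring.
Qed.

End SecondOrderRecurrence.

(** * Bounds on the gain over the triangle of rate [rho] *)

Section GainBounds.
Variable R : realType.
Implicit Types s p rho : R.

(* The triangle of coefficients [(s, p)] for which both roots of
   [z ^+ 2 - s * z + p] lie in the disc of radius [rho]. *)
Definition rho_triangle rho s p :=
  [/\ p <= rho ^+ 2, 0 <= rho ^+ 2 - s * rho + p & 0 <= rho ^+ 2 + s * rho + p].

(** The product that nonlinear arithmetic needs: [rho * (1 - s + p - (1 - rho) ^+ 2)], for example,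
    is this quantity plus [rho ^+ 2 - s * rho + p]. *)
Let subrho_p rho s p : 0 < rho < 1 -> rho_triangle rho s p ->
  0 <= (1 - rho) * (rho ^+ 2 - p).
Proof. by move=> /andP[rho0 rho1] tri; case: tri => h1 _ _; apply: mulr_ge0; lra. Qed.

Lemma rho_triangle_lower rho s p : 0 < rho < 1 -> rho_triangle rho s p ->
  (1 - rho) ^+ 2 <= 1 - s + p.
Proof.
move=> rho01 tri; have := subrho_p rho01 tri.
move: rho01 tri => /andP[rho0 rho1] [h1 h2 h3] h4.
rewrite -(ler_pM2l rho0); nra.
Qed.

Lemma rho_triangle_upper rho s p : 0 < rho < 1 -> rho_triangle rho s p ->
  1 - s + p <= (1 + rho) ^+ 2.
Proof.
move=> rho01 tri; have := subrho_p rho01 tri.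
move: rho01 tri => /andP[rho0 rho1] [h1 h2 h3] h4.
rewrite -(ler_pM2l rho0); nra.
Qed.

Lemma rho_triangle_stable rho s p : 0 < rho < 1 -> rho_triangle rho s p ->
  stable s p.
Proof.
move=> rho01 tri; have := subrho_p rho01 tri.
move: rho01 tri => /andP[rho0 rho1] [h1 h2 h3] h4.
have h5 : 0 < rho * (1 - rho) ^+ 2 by rewrite mulr_gt0// exprn_gt0// subr_gt0.
split; first nra.
  rewrite -(pmulr_rgt0 _ rho0); nra.
by rewrite -(pmulr_rgt0 _ rho0); nra.
Qed.

(** Both sides are affine in [(s, p)], so the vertices of the triangle decide. It trades the factor
    [1 - p] of the gain for [1 - s + p]. *)
Lemma rho_triangle_det rho s p : 0 < rho < 1 -> rho_triangle rho s p ->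
  (1 - rho) * (1 - p) <= 2 * (1 - s + p).
Proof.
move=> rho01 tri; have := subrho_p rho01 tri.
move: rho01 tri => /andP[rho0 rho1] [h1 h2 h3] h4.
(* After scaling by [rho], the gap is exactly twice the quantity of [h2] plus those of [h5] and
   [h6]. *)
have h5 : 0 <= (2 - rho) * ((1 - rho) * (rho ^+ 2 - p)) by apply: mulr_ge0; lra.
have h6 : 0 <= rho * (1 - rho) ^+ 2 * (1 - rho).
  by rewrite !mulr_ge0 ?exprn_ge0// ?subr_ge0 ltW.
rewrite -(ler_pM2l rho0); nra.
Qed.

Lemma gain_ge1 rho s p : 0 < rho < 1 -> rho_triangle rho s p ->
  1 <= gain s p.
Proof.
move=> rho01 tri; have [p1 sp sm] := rho_triangle_stable rho01 tri.
have D0 : 0 < (1 + p) ^+ 2 - s ^+ 2 by nra.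
rewrite /gain ler_pdivlMr; last by apply: mulr_gt0; lra.
rewrite mul1r.
(* Once [s ^+ 2] is dropped, [(1 - p) * (1 + p) <= 1] remains. *)
apply: (@le_trans _ _ ((1 - p) * (1 + p) ^+ 2)).
  by rewrite ler_pM2l ?subr_gt0// gerDl oppr_le0 sqr_ge0.
nra.
Qed.

Lemma gain_settling rho s p : 0 < rho < 1 -> rho_triangle rho s p ->
  (2 * (1 - s + p)) ^- 2 <= gain s p / (1 - rho).
Proof.
move=> rho01 tri; have [p1 sp sm] := rho_triangle_stable rho01 tri.
have det := rho_triangle_det rho01 tri; case/andP: rho01 => rho0 rho1.
(* Partial fractions; the term in [1 + s + p] is then dropped, and [det] bounds the denominator of
   the other. *)
have -> : gain s p = (2 * (1 - p) * (1 + s + p))^-1 + (2 * (1 - p) * (1 - s + p))^-1.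
  rewrite /gain; field; apply/and4P; split; apply: lt0r_neq0; first [lra | nra].
apply: (@le_trans _ _ ((2 * (1 - p) * (1 - s + p))^-1 / (1 - rho))); last first.
  rewrite ler_pM2r ?invr_gt0; last lra.
  by rewrite lerDr invr_ge0 !mulr_ge0//; lra.
rewrite -invfM lef_pV2 ?posrE; last 2 first.
- by apply: exprn_gt0; lra.
- by apply: mulr_gt0; last lra; apply: mulr_gt0 => //; lra.
nra.
Qed.

End GainBounds.

(** * Eigenvalues and the spectral trace formula *)

Section Eigenvalues.

Lemma eigenvalue_diag_mx (F : fieldType) n (d : 'rV[F]_n) a :
  eigenvalue (diag_mx d) a <-> exists i, d 0 i = a.
Proof.
split=> [/eigenvalueP [v + v0]|[j <-]].
  have /rV0Pn [i vi0] := v0.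
  move=> /rowP /(_ i); rewrite mul_mx_diag !mxE mulrC => /(mulIf vi0) <-.
  by exists i.
apply/eigenvalueP; exists (delta_mx 0 j).
  apply/rowP => k; rewrite mul_mx_diag !mxE eqxx /=.
  by have [->|] := eqVneq; rewrite ?mulr1 ?mul1r ?mul0r ?mulr0.
apply/eqP => /rowP /(_ j) /eqP; rewrite !mxE !eqxx /=.
by rewrite oner_eq0.
Qed.

Lemma eigenvalue_uconj (F : fieldType) n (P A : 'M[F]_n) a : P \in unitmx ->
  eigenvalue (invmx P *m A *m P) a = eigenvalue A a.
Proof.
move=> Pu; apply/eigenvalueP/eigenvalueP => -[v vE v0].
  exists (v *m invmx P).
    by rewrite scalemxAl -vE !mulmxA mulmxK.
  by apply: contra_neq v0 => /(congr1 (mulmx^~ P)); rewrite mulmxKV// mul0mx.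
exists (v *m P); first by rewrite !mulmxA mulmxK// vE scalemxAl.
by apply: contra_neq v0 => /(congr1 (mulmx^~ (invmx P))); rewrite mulmxK// mul0mx.
Qed.

Variable R : realType.
Local Notation toC := (real_complex R).

(** The spectral theorem for the complexified matrix, whose diagonal is real. Only eigenvalues and
    traces of polynomials are carried back to [R], so no real eigenbasis is built. *)
Lemma horner_mx_trace_sym n (Q : 'M[R]_n.+1) : Q^T = Q ->
  exists lam : 'I_n.+1 -> R,
    (forall a, eigenvalue Q a <-> exists i, lam i = a) /\
    (forall p : {poly R}, \tr (horner_mx Q p) = \sum_i p.[lam i]).
Proof.
move=> Qsym; pose QC := map_mx toC Q.
have QCherm : QC \is hermsymmx.
  apply/is_hermitianmxP; rewrite expr0 scale1r; apply/matrixP => i j.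
  rewrite !mxE -{1}Qsym mxE.
  by rewrite -[Num.conj]/(@conjc R) /= oppr0.
have /orthomx_spectralP QCE := hermitian_normalmx QCherm.
have /mxOverP spreal := hermitian_spectral_diag_real QCherm.
set P := spectralmx QC in QCE; set sp := spectral_diag QC in QCE spreal.
have Pu : P \in unitmx by exact: spectral_unit.
pose lam i := complex.Re (sp 0 i).
have lamE i : toC (lam i) = sp 0 i by apply: RRe_real; exact: spreal.
exists lam; split => [a|p].
  rewrite -(eigenvalue_map toC) -/QC QCE eigenvalue_uconj//.
  rewrite eigenvalue_diag_mx.
  split=> -[j]; rewrite -?lamE => jE; exists j; last by rewrite -lamE jE.
  exact: complexI jE.
apply: (@complexI R); rewrite -trace_map_mx.
rewrite (map_horner_mx toC) -/QC QCE horner_mx_uconjC//.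
rewrite mxtrace_mulC mulmxA mulmxV// mul1mx horner_mx_diag mxtrace_diag.
rewrite rmorph_sum; apply: eq_bigr => i _.
by rewrite !mxE -lamE horner_map.
Qed.

End Eigenvalues.

(** * Modal polynomials and the spectrum of the state matrix *)

Section ModalPolynomial.
Variable R : realType.
Implicit Types (s p rho : R).
Local Notation toC := (real_complex R).

Lemma roots_in_disc_rho_triangle rho s p : 0 <= rho ->
  (forall z : R[i], z ^+ 2 - toC s * z + toC p = 0 -> `|z| <= toC rho) ->
  rho_triangle rho s p.
Proof.
move=> rho0 H; have [D0|D0] := leP 0 (s ^+ 2 - 4 * p).
  pose q := Num.sqrt (s ^+ 2 - 4 * p).
  have q2 : q ^+ 2 = s ^+ 2 - 4 * p by rewrite sqr_sqrtr.
  have HR (x : R) : x ^+ 2 - s * x + p = 0 -> - rho <= x <= rho.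
    move=> xE; rewrite -ler_norml.
    have := H (toC x); rewrite -rmorphXn -rmorphM -rmorphB -rmorphD xE => /(_ erefl).
    by rewrite normc_def /= expr0n addr0 sqrtr_sqr lecR.
  have /HR/andP[l1 u1] : ((s + q) / 2) ^+ 2 - s * ((s + q) / 2) + p = 0 by nra.
  have /HR/andP[l2 u2] : ((s - q) / 2) ^+ 2 - s * ((s - q) / 2) + p = 0 by nra.
  have pE : p = ((s + q) / 2) * ((s - q) / 2) by nra.
  have sE : s = ((s + q) / 2) + ((s - q) / 2) by lra.
  set z1 := (s + q) / 2 in l1 u1 pE sE; set z2 := (s - q) / 2 in l2 u2 pE sE.
  (* The edge expressions factor as [(rho - z1) * (rho - z2)] and [(rho + z1) * (rho + z2)]. *)
  rewrite /rho_triangle sE pE; split; nra.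
(* For conjugate roots the squared modulus is [p], and each edge expression is a square plus
   [p - s ^+ 2 / 4 > 0]. *)
pose q := Num.sqrt (4 * p - s ^+ 2).
have q2 : q ^+ 2 = 4 * p - s ^+ 2 by rewrite sqr_sqrtr//; lra.
have /H : (Complex (s / 2) (q / 2)) ^+ 2 - toC s * Complex (s / 2) (q / 2) + toC p = 0.
  rewrite expr2; apply/eqP; rewrite eq_complex.
  by apply/andP; split; apply/eqP; rewrite /=; nra.
rewrite normc_def lecR /= -{1}(ger0_norm rho0) -sqrtr_sqr ler_sqrt ?sqr_ge0// => h.
have := sqr_ge0 (rho - s / 2); have := sqr_ge0 (rho + s / 2).
by split; nra.
Qed.

Lemma eigenvalue_momentum_matrix n (Q : 'M[R]_n) alpha beta gamma lam (z : R[i]) :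
  eigenvalue Q lam ->
  z ^+ 2 - toC (1 + beta - (1 + gamma) * alpha * lam) * z
    + toC (beta - gamma * alpha * lam) = 0 ->
  eigenvalue (map_mx toC (momentum_matrix alpha beta gamma Q)) z.
Proof.
move=> /eigenvalueP [v vQ v0] zE.
set s := 1 + beta - _ in zE; set p := beta - _ in zE.
pose vC := map_mx toC v.
(* [eigenvalue] refers to row vectors, so the witness is a left eigenvector of the block companion
   matrix. *)
apply/eigenvalueP; exists (row_mx ((z - toC s) *: vC) vC); last first.
  apply: contra_neq v0 => /(congr1 rsubmx); rewrite row_mxKr linear0 => vC0.
  by apply/eqP; rewrite -(map_mx_eq0 toC); apply/eqP.
rewrite /momentum_matrix map_block_mx mul_row_block scale_row_mx.
have vA a b : v *m (a%:M + b *: Q) = (a + b * lam) *: v.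
  by rewrite mulmxDr mul_mx_scalar -scalemxAr vQ scalerA scalerDl.
have vB a b : v *m (a%:M - b *: Q) = (a - b * lam) *: v.
  by rewrite -scaleNr vA mulNr.
rewrite -!map_mxM vA vB map_mx0 mulmx0 add0r map_mx1 mulmx1 !map_mxZ -scalerDl scalerA.
congr row_mx; congr (_ *: _).
  have -> : - beta + gamma * alpha * lam = - p by rewrite /p opprB addrC.
  apply/eqP; rewrite rmorphN eq_sym -addr_eq0 mulrBr -expr2 (mulrC z).
  exact/eqP.
exact: subrK.
Qed.

End ModalPolynomial.

(** * Means, integrability and white noise *)

Section Mean.
Context {R : realType} {d : measure_display} {Omega : measurableType d}.
Variable P : probability Omega R.
Implicit Types (f g : Omega -> R) (a b c : R).

(** Integrability is bundled with the value because linearity of the integral requires it. *)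
Definition has_mean f a :=
  P.-integrable setT (EFin \o f) /\ (\int[P]_x (f x)%:E = a%:E)%E.

Lemma has_mean_cst c : has_mean (fun=> c) c.
Proof.
split; first exact: finite_measure_integrable_cst.
rewrite integral_cst//; apply: etrans (mule1 _).
by congr (_ * _)%E; exact: probability_setT.
Qed.

Lemma has_meanD f g a b :
  has_mean f a -> has_mean g b -> has_mean (fun x => f x + g x) (a + b).
Proof.
move=> [fi fE] [gi gE]; split; first exact: (integrableD measurableT fi gi).
by rewrite EFinD -fE -gE -(integralD measurableT fi gi).
Qed.

Lemma has_meanZ c f a : has_mean f a -> has_mean (fun x => c * f x) (c * a).
Proof.
move=> [fi fE]; split; first exact: (integrableZl measurableT c fi).
by rewrite EFinM -fE -(integralZl measurableT fi c).
Qed.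

Lemma has_mean_sum (I : Type) (r : seq I) (f : I -> Omega -> R) (a : I -> R) :
  (forall i, has_mean (f i) (a i)) ->
  has_mean (fun x => \sum_(i <- r) f i x) (\sum_(i <- r) a i).
Proof.
move=> fa; elim: r => [|i r IH].
  rewrite big_nil; under eq_fun do rewrite big_nil; exact: has_mean_cst.
rewrite big_cons; under eq_fun do rewrite big_cons; exact: has_meanD.
Qed.

Lemma eq_has_mean f g a b : f =1 g -> a = b -> has_mean f a -> has_mean g b.
Proof. by move=> /funext -> ->. Qed.

(** When the square is expanded, the linear terms have mean zero and orthonormality leaves only the
    diagonal products. *)
Lemma has_mean_sqr_affine (J : finType) (X : J -> Omega -> R) (u : J -> R) c :
  (forall j, has_mean (X j) 0) ->
  (forall i j, has_mean (fun x => X i x * X j x) (i == j)%:R) ->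
  has_mean (fun x => (c + \sum_j u j * X j x) ^+ 2) (c ^+ 2 + \sum_j u j ^+ 2).
Proof.
move=> X0 X1.
apply: (@eq_has_mean (fun x => c ^+ 2 + \sum_j (2 * c * u j) * X j x
    + \sum_i \sum_j (u i * u j) * (X i x * X j x)) _
  (c ^+ 2 + \sum_j (2 * c * u j) * 0 + \sum_i \sum_j (u i * u j) * (i == j)%:R)).
- move=> x; rewrite sqrrD expr2 -addrA -addrA; congr (_ + (_ + _)).
    rewrite mulr_sumr -sumrMnl; apply: eq_bigr => j _; ring.
  rewrite [RHS]expr2 mulr_suml; apply: eq_bigr => i _.
  by rewrite mulr_sumr; apply: eq_bigr => j _; ring.
- rewrite [\sum_j _ * 0]big1 ?addr0; last by move=> *; rewrite mulr0.
  congr (_ + _); apply: eq_bigr => i _.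
  rewrite (bigD1 i)//= eqxx mulr1 big1 ?addr0 ?expr2// => j ji.
  by rewrite eq_sym (negPf ji) mulr0.
- apply: has_meanD; first apply: has_meanD; first exact: has_mean_cst.
    by apply: has_mean_sum => j; apply: has_meanZ.
  by apply: has_mean_sum => i; apply: has_mean_sum => j; apply: has_meanZ.
Qed.

Variables (n : nat) (w : nat -> Omega -> 'cV[R]_n).
Hypothesis wn : white_noise P w.

(** [white_noise] states no integrability; it follows from measurability and the finite second
    moment. *)
Let integrable_sqr_noise t i :
  P.-integrable setT (EFin \o (fun x => w t x i ord0 ^+ 2)).
Proof.
case: wn => mw _ w2; apply/integrableP; split.
  by apply/measurable_EFinP; apply: measurable_funX; exact: mw.
under eq_integral do rewrite /= ger0_norm ?sqr_ge0// expr2.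
by rewrite w2 !eqxx/= ltry.
Qed.

(** A noise entry is dominated by one plus its square, which is integrable on a probability
    space. *)
Lemma white_noise_mean t i : has_mean (fun x => w t x i ord0) 0.
Proof.
case: wn => mw w1 w2; split; last exact: w1.
apply: (le_integrable measurableT
  (g := EFin \o (fun x => 1 + w t x i ord0 ^+ 2))).
- by apply/measurable_EFinP; exact: mw.
- move=> x _ /=; rewrite lee_fin [X in _ <= X]ger0_norm; last first.
    by rewrite addr_ge0 ?sqr_ge0.
  rewrite -(real_normK (num_real _)).
  by have := sqr_ge0 (`|w t x i ord0| - 1); have := normr_ge0 (w t x i ord0); nra.
- exact: (integrableD measurableT (finite_measure_integrable_cst P 1 measurableT)
    (integrable_sqr_noise t i)).
Qed.

Lemma white_noise_cov t s i j :
  has_mean (fun x => w t x i ord0 * w s x j ord0) ((t == s) && (i == j))%:R.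
Proof.
case: wn => mw w1 w2; split; last by rewrite w2; case: ifP.
apply: (le_integrable measurableT
  (g := EFin \o (fun x => w t x i ord0 ^+ 2 + w s x j ord0 ^+ 2))).
- by apply/measurable_EFinP; apply: measurable_funM; exact: mw.
- move=> x _ /=; rewrite lee_fin [X in _ <= X]ger0_norm; last first.
    by rewrite addr_ge0 ?sqr_ge0.
  rewrite normrM -(real_normK (num_real (w t x i _))) -(real_normK (num_real (w s x j _))).
  have := normr_ge0 (w t x i ord0); have := normr_ge0 (w s x j ord0).
  by have := sqr_ge0 (`|w t x i ord0| - `|w s x j ord0|); nra.
- exact: (integrableD measurableT (integrable_sqr_noise t i)
    (integrable_sqr_noise s j)).
Qed.

(** The pairs of a time and a coordinate index one orthonormal family, so [has_mean_sqr_affine]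
    applies to each coordinate. *)
Lemma has_mean_sqnorm_affine k (c : 'cV[R]_n) (M : 'I_k -> 'M[R]_n) :
  has_mean (fun x => sqnorm (c + \sum_s M s *m w s x))
    (sqnorm c + \sum_s \sum_i \sum_j M s i j ^+ 2).
Proof.
apply: (@eq_has_mean
  (fun x => \sum_(i < n)
     (c i ord0 + \sum_(sj : 'I_k * 'I_n) M sj.1 i sj.2 * w sj.1 x sj.2 ord0) ^+ 2)
  _ (\sum_(i < n) (c i ord0 ^+ 2 + \sum_(sj : 'I_k * 'I_n) M sj.1 i sj.2 ^+ 2))).
- move=> x; apply: eq_bigr => i _; rewrite mxE summxE; congr ((_ + _) ^+ 2).
  rewrite -(pair_bigA _ (fun s j => M s i j * w s x j ord0))/=.
  by apply: eq_bigr => s _; rewrite mxE.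
- rewrite big_split/=; congr (_ + _); rewrite exchange_big/=.
  rewrite -(pair_bigA _ (fun s j => \sum_i M s i j ^+ 2))/=.
  by apply: eq_bigr => s _; rewrite exchange_big.
- apply: has_mean_sum => i.
  apply: (@has_mean_sqr_affine _ (fun sj x => w (val sj.1) x sj.2 ord0)
    (fun sj => M sj.1 i sj.2)) => [sj|si sj]; first exact: white_noise_mean.
  apply: eq_has_mean (white_noise_cov si.1 sj.1 si.2 sj.2) => //.
Qed.

End Mean.

(** * Frobenius norms as traces *)

Section FrobeniusTrace.
Variables (R : realType) (n : nat).

Definition sqfrob (M : 'M[R]_n) : R := \sum_i \sum_j M i j ^+ 2.

Lemma sqfrob_trace (M : 'M[R]_n) : sqfrob M = \tr (M *m M^T).
Proof.
by apply: eq_bigr => i _; rewrite mxE; apply: eq_bigr => j _; rewrite mxE expr2.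
Qed.

Lemma sqfrobZ a (M : 'M[R]_n) : sqfrob (a *: M) = a ^+ 2 * sqfrob M.
Proof.
rewrite /sqfrob mulr_sumr; apply: eq_bigr => i _.
by rewrite mulr_sumr; apply: eq_bigr => j _; rewrite mxE exprMn.
Qed.

Lemma sqr_entry_le_sqfrob (M : 'M[R]_n) i j : M i j ^+ 2 <= sqfrob M.
Proof.
rewrite /sqfrob (bigD1 i)//= (bigD1 j)//= -addrA lerDl.
by rewrite addr_ge0 ?sumr_ge0// => k _; rewrite ?sumr_ge0// => *; rewrite sqr_ge0.
Qed.

End FrobeniusTrace.

(** Makes the squared Frobenius norm of a polynomial in [Q] the trace of its square, again a
    polynomial in [Q]. *)
Lemma trmx_horner_mx (R : comNzRingType) n (Q : 'M[R]_n.+1) (p : {poly R}) :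
  Q^T = Q -> (horner_mx Q p)^T = horner_mx Q p.
Proof.
move=> Qsym; elim/poly_ind: p => [|p c IH]; first by rewrite rmorph0 trmx0.
rewrite rmorphD rmorphM /= horner_mx_X horner_mx_C linearD /= tr_scalar_mx.
by rewrite trmx_mul IH Qsym; congr (_ + _); apply/esym/comm_horner_mx.
Qed.

(** * Limits of finite sums and of time averages *)

Section Averages.
Variable R : realType.
Local Open Scope classical_set_scope.

Lemma cvg_sumr (I : Type) (r : seq I) (f : I -> nat -> R) (l : I -> R) :
  (forall i, f i k @[k --> \oo] --> l i) ->
  \sum_(i <- r) f i k @[k --> \oo] --> \sum_(i <- r) l i.
Proof. by move=> fl; apply: cvg_big => //; exact: add_continuous. Qed.

Lemma cvg_sumr0 (I : Type) (r : seq I) (f : I -> nat -> R) :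
  (forall i, f i k @[k --> \oo] --> 0) -> \sum_(i <- r) f i k @[k --> \oo] --> 0.
Proof. by move=> f0; have := @cvg_sumr I r f (fun=> 0) f0; rewrite big1_eq. Qed.

Lemma cvg_sqr0 (f : nat -> R) :
  f k @[k --> \oo] --> 0 -> f k ^+ 2 @[k --> \oo] --> 0.
Proof. by move=> f0; rewrite -[X in _ --> X](mulr0 0); exact: cvgM. Qed.

Lemma cvg_lin0 (f g : nat -> R) a b :
  f k @[k --> \oo] --> 0 -> g k @[k --> \oo] --> 0 ->
  f k * a + g k * b @[k --> \oo] --> 0.
Proof.
move=> f0 g0; rewrite -[X in _ --> X](_ : 0 * a + 0 * b = 0); last by ring.
by apply: cvgD; apply: cvgM => //; exact: cvg_cst.
Qed.

(* [noise_amp] divides a sum of [t.+1] terms by [t], one off from a mean. *)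
Lemma cesaro_pred (v : nat -> R) (l : R) : v k @[k --> \oo] --> l ->
  t%:R^-1 * \sum_(0 <= k < t.+1) v k @[t --> \oo] --> l.
Proof.
move=> vl; rewrite -cvg_shiftS /=.
have -> : (fun t => t.+1%:R^-1 * \sum_(0 <= k < t.+2) v k) =
    (fun t => arithmetic_mean v t + harmonic t * v t.+1).
  by apply/funext => t; rewrite big_nat_recr//= mulrDr.
rewrite -[l]addr0; apply: cvgD; first exact: cesaro.
rewrite -[X in _ --> X](mul0r l); apply: cvgM; first exact: cvg_harmonic.
by move: vl; rewrite -cvg_shiftS.
Qed.

End Averages.

(** * Error dynamics and the exact noise amplification *)

Section Dynamics.
Variables (R : realType) (n' : nat).
Local Notation n := n'.+1.
Variables (alpha beta gamma sigw : R).

Definition root_sum (l : R) := 1 + beta - (1 + gamma) * alpha * l.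
Definition root_prod (l : R) := beta - gamma * alpha * l.

Let sP : {poly R} := (1 + beta)%:P - ((1 + gamma) * alpha) *: 'X.
Let pP : {poly R} := beta%:P - (gamma * alpha) *: 'X.
(** Polynomials in the eigenvalue: evaluated at [l] they give the scalar mode, at [Q] the matrix
    response [U]. *)
Let uP c0 c1 k : {poly R} := lrec sP pP c0%:P c1%:P k.

Let uP_horner c0 c1 k l :
  (uP c0 c1 k).[l] = lrec (root_sum l) (root_prod l) c0 c1 k.
Proof.
rewrite -horner_evalE rmorph_lrec /= !horner_evalE !hornerE.
by rewrite /root_sum /root_prod.
Qed.

Variables (Q : 'M[R]_n) (q xs : 'cV[R]_n) (lam : 'I_n -> R).
Hypotheses (Qsym : Q^T = Q) (Qxs : Q *m xs = q).
Hypothesis Qtr : forall p : {poly R}, \tr (horner_mx Q p) = \sum_i p.[lam i].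
Hypothesis Qsta : forall i, stable (root_sum (lam i)) (root_prod (lam i)).

Let U c0 c1 k := horner_mx Q (uP c0 c1 k).

Let USS c0 c1 k : U c0 c1 k.+2 =
  ((1 + beta)%:M - ((1 + gamma) * alpha) *: Q) *m U c0 c1 k.+1
  - (beta%:M - (gamma * alpha) *: Q) *m U c0 c1 k.
Proof.
rewrite /U /uP lrecSS rmorphB !rmorphM /= -/(uP c0 c1 k) -/(uP c0 c1 k.+1).
by rewrite !rmorphB /= !linearZ /= !horner_mx_C !horner_mx_X.
Qed.

Let sqfrob_U c0 c1 k : sqfrob (U c0 c1 k) =
  \sum_i lrec (root_sum (lam i)) (root_prod (lam i)) c0 c1 k ^+ 2.
Proof.
rewrite sqfrob_trace trmx_horner_mx// [_ *m _](_ : _ = horner_mx Q (uP c0 c1 k ^+ 2)).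
  by rewrite Qtr; apply: eq_bigr => i _; rewrite horner_exp uP_horner.
by rewrite rmorphXn expr2.
Qed.

Variables (x0 x1 : 'cV[R]_n).

(** The deterministic, noise-free part of the error, not a determinant. *)
Let det k := U 1 0 k *m (x0 - xs) + U 0 1 k *m (x1 - xs).

(** The noise [e s] first acts on the iterate of index [s + 2], hence [k.-1 - s]: the last term of
    the sum carries [U 0 1 0 = 0]. *)
Lemma error_closed_form (e : nat -> 'cV[R]_n) k :
  (iterates alpha beta gamma sigw Q q x0 x1 e k).1 - xs =
  det k + \sum_(0 <= s < k) (sigw *: U 0 1 (k.-1 - s)) *m e s.
Proof.
have U0 c0 c1 : U c0 c1 0 = c0%:M by rewrite /U /uP /lrec/= horner_mx_C.
have U1 c0 c1 : U c0 c1 1 = c1%:M by rewrite /U /uP /lrec/= horner_mx_C.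
elim/nat_ind2: k => [||k IH0 IH1].
- by rewrite /det !U0 big_nil mul1mx mul_scalar_mx scale0r !addr0.
- rewrite /det !U1 big_nat1 U0 -scalemxAl mul1mx !mul_scalar_mx !scale0r.
  by rewrite scaler0 add0r addr0.
set it := iterates _ _ _ _ _ _ _ _ _ in IH0 IH1 *.
have itSS : (it k.+2).1 = (it k.+1).1 + beta *: ((it k.+1).1 - (it k).1)
   - alpha *: grad_quad Q q ((it k.+1).1 + gamma *: ((it k.+1).1 - (it k).1))
   + sigw *: e k.
  rewrite /it /=; by case: (iterates alpha beta gamma sigw Q q x0 x1 e k).
have -> : (it k.+2).1 - xs =
   ((1 + beta)%:M - ((1 + gamma) * alpha) *: Q) *m ((it k.+1).1 - xs)
   - (beta%:M - (gamma * alpha) *: Q) *m ((it k).1 - xs) + sigw *: e k.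
  rewrite itSS /grad_quad -Qxs.
  move: (it k.+1).1 (it k).1 => a b.
  rewrite !(mulmxBl, mulmxBr, mulmxDr, mul_scalar_mx, =^~ scalemxAl, =^~ scalemxAr).
  move: (Q *m a) (Q *m b) (Q *m xs) => Qa Qb Qx.
  by apply/colP => i; rewrite !mxE; ring.
(* All three sums are cut to [s < k]. Two of the split-off terms carry [U 0 1 0 = 0]; the third
   carries [U 0 1 1 = 1] and is the fresh noise [sigw *: e k]. *)
rewrite IH0 IH1; apply/esym; do 3 rewrite big_nat_recr//=.
rewrite !subnn subSnn !U0 U1.
rewrite -!scalemxAl mul1mx !mul_scalar_mx !scale0r scaler0 !addr0.
have combine (S T A1 A0 B1 B0 : 'M[R]_n) (x y : 'cV[R]_n) :
    (S *m A1 - T *m A0) *m x + (S *m B1 - T *m B0) *m y =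
    S *m (A1 *m x + B1 *m y) - T *m (A0 *m x + B0 *m y).
  by rewrite !mulmxBl !mulmxDr opprD addrACA !mulmxA.
have -> : det k.+2 = ((1 + beta)%:M - ((1 + gamma) * alpha) *: Q) *m det k.+1
    - (beta%:M - (gamma * alpha) *: Q) *m det k.
  by rewrite /det !USS combine.
set S := (1 + beta)%:M - _; set T := beta%:M - _.
rewrite (eq_big_nat _ _ (F2 := fun s => S *m (sigw *: U 0 1 (k - s) *m e s)
    - T *m (sigw *: U 0 1 (k.-1 - s) *m e s))); last first.
  move=> s /andP[_ sk].
  have [-> ->] : (k.+1 - s = (k.-1 - s).+2 /\ k - s = (k.-1 - s).+1)%N by lia.
  by rewrite USS scalerBr mulmxBl -!scalemxAl -!scalemxAr !mulmxA.
move: (det k) (det k.+1) => D0 D1.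
rewrite /= sumrB !mulmxDr !mulmx_sumr.
move: (S *m D1) (T *m D0) (\sum_(_ <= _ < _) S *m _) (\sum_(_ <= _ < _) T *m _).
by move=> a b c f; apply/colP => i; rewrite !mxE; ring.
Qed.

Local Open Scope classical_set_scope.

(** Entries of [U] are bounded by its Frobenius norm, a finite sum of squared stable modes. *)
Lemma error_response_cvg0 : (sqnorm (det k) @[k --> \oo] --> (0 : R)).
Proof.
have Uc c0 c1 i j : (U c0 c1 k i j @[k --> \oo] --> (0 : R)).
  apply/norm_cvg0P; rewrite -[X in _ --> X]sqrtr0.
  under eq_fun do rewrite -sqrtr_sqr.
  apply: continuous_cvg; first exact: sqrt_continuous.
  apply: (@squeeze_cvgr _ _ _ _ (fun=> 0) (fun k => sqfrob (U c0 c1 k))).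
  - by apply: nearW => k; rewrite sqr_ge0 sqr_entry_le_sqfrob.
  - exact: cvg_cst.
  under eq_fun do rewrite sqfrob_U.
  by apply: cvg_sumr0 => l; apply: cvg_sqr0; exact: cvg_lrec.
rewrite /sqnorm; apply: cvg_sumr0 => i; apply: cvg_sqr0.
have -> : (fun k => det k i ord0) = (fun k => \sum_j
    (U 1 0 k i j * (x0 - xs) j ord0 + U 0 1 k i j * (x1 - xs) j ord0)).
  by apply/funext => k; rewrite big_split [LHS]mxE; congr (_ + _); rewrite [LHS]mxE.
by apply: cvg_sumr0 => j; exact: cvg_lin0.
Qed.

Context {d : measure_display} {Omega : measurableType d} (P : probability Omega R).
Variable w : nat -> Omega -> 'cV[R]_n.
Hypothesis wn : white_noise P w.

Lemma msdE k : msd P w x0 x1 alpha beta gamma sigw Q q xs k =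
  (sqnorm (det k) + sigw ^+ 2 * \sum_i
     series (fun k => lrec (root_sum (lam i)) (root_prod (lam i)) 0 1 k ^+ 2) k)%:E.
Proof.
rewrite /msd.
under eq_integral do rewrite error_closed_form big_mkord.
have [_ ->] := has_mean_sqnorm_affine wn (det k) (fun s : 'I_k => sigw *: U 0 1 (k.-1 - s)).
congr ((_ + _)%:E).
under eq_bigr do rewrite -/(sqfrob _) sqfrobZ sqfrob_U.
rewrite -mulr_sumr; congr (_ * _).
rewrite exchange_big /=; apply: eq_bigr => i _.
(* Reversing the order of summation turns [k.-1 - s] into the index of a partial sum. *)
rewrite /series /= big_nat_rev /= big_mkord; apply: eq_bigr => s _.
by rewrite add0n -subn1 -subnDA add1n.
Qed.

(** The mean square error itself converges, so its time averages share the limit. [lam] is known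
    only through [Qtr] and [Qsta], which suits explicit diagonal and general symmetric matrices
    alike. *)
Lemma noise_ampE : noise_amp P w x0 x1 alpha beta gamma sigw Q q xs =
  (sigw ^+ 2 * \sum_i gain (root_sum (lam i)) (root_prod (lam i)))%:E.
Proof.
rewrite /noise_amp; under eq_fun do (under eq_bigr do rewrite msdE; rewrite sumEFin -EFinM).
apply/cvg_lim => //; apply/cvg_EFin; first exact: nearW.
apply: cesaro_pred; rewrite -[X in _ --> X]add0r.
apply: cvgD; first exact: error_response_cvg0.
apply: cvgM; first exact: cvg_cst.
by apply: cvg_sumr => i; exact: cvg_series_impulse.
Qed.

End Dynamics.

(** * Lower bounds for a single mode *)

Section ModeBounds.
Variables (R : realType) (m L alpha beta gamma rho : R).
Hypotheses (m0 : 0 < m) (mL : m <= L) (rho01 : 0 < rho < 1).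

Local Notation s := (root_sum alpha beta gamma).
Local Notation p := (root_prod alpha beta gamma).
Local Notation g l := (gain (s l) (p l)).
Local Notation Ts := (1 - rho)^-1.
Local Notation kappa := (L / m).

Hypothesis tri : forall l, l = m \/ l = L -> rho_triangle rho (s l) (p l).

(** The modal polynomial at [z = 1], where [beta] and [gamma] cancel. *)
Let root_at1 l : 1 - s l + p l = alpha * l.
Proof. by rewrite /root_sum /root_prod; ring. Qed.

Let L0 : 0 < L. Proof. exact: lt_le_trans mL. Qed.

Let rho1 : 0 < 1 - rho. Proof. by case/andP: rho01 => _; rewrite subr_gt0. Qed.

Let Ts0 : 0 < Ts. Proof. by rewrite invr_gt0. Qed.

Let alpha_m : (1 - rho) ^+ 2 <= alpha * m.
Proof. by rewrite -root_at1; apply: rho_triangle_lower => //; apply: tri; left. Qed.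

Let alpha_L : alpha * L <= (1 + rho) ^+ 2.
Proof. by rewrite -root_at1; apply: rho_triangle_upper => //; apply: tri; right. Qed.

Let alpha0 : 0 < alpha.
Proof.
rewrite -(pmulr_lgt0 _ m0); apply: lt_le_trans alpha_m.
by rewrite exprn_gt0.
Qed.

(** The ratio of [alpha_L] to [alpha_m] bounds the root of [kappa] by [(1 + rho) / (1 - rho)], which
    is [2 * Ts - 1]. *)
Lemma settling_time_ge : (Num.sqrt kappa + 1) / 2 <= Ts.
Proof.
have k0 : 0 <= kappa by rewrite divr_ge0 ?ltW.
have := sqr_sqrtr k0; have := sqrtr_ge0 kappa.
move: (Num.sqrt kappa) => r r0 r2.
have kE : kappa * m = L by rewrite divfK// gt_eqF.
have h : r * (1 - rho) <= 1 + rho.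
  rewrite -(ler_pXn2r (n := 2)) ?nnegrE//; last 2 first.
  - by rewrite mulr_ge0// ltW.
  - by case/andP: rho01 => r_0 _; lra.
  rewrite exprMn r2; apply: le_trans alpha_L.
  have -> : alpha * L = kappa * (alpha * m) by rewrite mulrCA kE.
  exact: ler_wpM2l.
by rewrite -[leRHS]mul1r ler_pdivlMr// mulrAC ler_pdivrMr//; lra.
Qed.

Lemma mode_bound_iterate l : rho_triangle rho (s l) (p l) ->
  (Num.sqrt kappa + 1) / 2 <= g l * Ts.
Proof.
move=> /(gain_ge1 rho01) gl; apply: le_trans settling_time_ge _.
by rewrite ler_peMl// ltW.
Qed.

Let mode_settling l : rho_triangle rho (s l) (p l) ->
  (2 * (alpha * l)) ^- 2 <= g l * Ts.
Proof. by move=> /(gain_settling rho01); rewrite root_at1. Qed.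

(** The constant 64 comes from [alpha * L <= 4]: then [kappa <= 4 / (alpha * m)], while
    [mode_settling] supplies [1 / (4 * (alpha * m) ^+ 2)]. *)
Lemma mode_bound_iterate_m : kappa ^+ 2 / 64 <= g m * Ts.
Proof.
apply: le_trans (mode_settling (tri (or_introl erefl))).
have am0 : 0 < alpha * m by rewrite mulr_gt0.
have aL4 : alpha * L <= 4.
  apply: le_trans alpha_L _; case/andP: rho01 => *; nra.
have -> : kappa = (alpha * L) / (alpha * m).
  by field; rewrite !gt_eqF.
have : 0 <= alpha * L by rewrite mulr_ge0// ltW.
move: (alpha * L) (alpha * m) aL4 am0 => x y x4 y0 x0.
have -> : (x / y) ^+ 2 / 64 = x ^+ 2 / 64 * y ^- 2 by field; rewrite gt_eqF.
have -> : (2 * y) ^- 2 = 4^-1 * y ^- 2 by field; rewrite gt_eqF.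
by rewrite ler_pM2r ?invr_gt0 ?exprn_gt0//; nra.
Qed.

Lemma mode_bound_gradient l : 0 < l -> rho_triangle rho (s l) (p l) ->
  (4 * l ^+ 2)^-1 <= alpha ^+ 2 * (g l * Ts).
Proof.
move=> l0 /mode_settling gl.
have -> : (4 * l ^+ 2)^-1 = alpha ^+ 2 * (2 * (alpha * l)) ^- 2.
  by field; rewrite !gt_eqF.
by rewrite ler_wpM2l ?sqr_ge0.
Qed.

Lemma mode_bound_gradient_m : L ^- 2 * (kappa ^+ 2 / 4) <= alpha ^+ 2 * (g m * Ts).
Proof.
apply: le_trans (mode_bound_gradient m0 (tri (or_introl erefl))).
rewrite le_eqVlt; apply/orP; left; apply/eqP.
by field; rewrite !gt_eqF.
Qed.

(** Two separate arguments: [4^-1] comes from [mode_bound_gradient] and [l <= L], the other entry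
    from a gain of at least one and [alpha >= (1 - rho) ^+ 2 / m]. *)
Lemma mode_bound_gradient_max l : 0 < l <= L -> rho_triangle rho (s l) (p l) ->
  L ^- 2 * Num.max (kappa ^+ 2 / Ts ^+ 3) 4^-1 <= alpha ^+ 2 * (g l * Ts).
Proof.
move=> /andP[l0 lL] tril; rewrite maxr_pMr ?invr_ge0 ?exprn_ge0 ?(ltW L0)//.
rewrite ge_max; apply/andP; split; last first.
  apply: le_trans (mode_bound_gradient l0 tril).
  rewrite -invfM lef_pV2 ?posrE ?mulr_gt0 ?exprn_gt0//.
  by rewrite mulrC ler_pM2r// ler_pXn2r// nnegrE ltW.
have g1 := gain_ge1 rho01 tril.
apply: (@le_trans _ _ (alpha ^+ 2 * Ts)); last first.
  by rewrite ler_wpM2l ?sqr_ge0// ler_peMl// ltW.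
have -> : L ^- 2 * (kappa ^+ 2 / Ts ^+ 3) = ((1 - rho) ^+ 2 / m) ^+ 2 * Ts.
  by field; rewrite !gt_eqF.
rewrite ler_pM2r// ler_pXn2r ?nnegrE ?divr_ge0 ?exprn_ge0 ?(ltW m0) ?(ltW alpha0) ?(ltW rho1)//.
by rewrite ler_pdivrMr.
Qed.

End ModeBounds.

(** Serves to single out one mode at an extreme eigenvalue from the rest of the spectrum. *)
Lemma sum_ge_split (R : realDomainType) n (f : 'I_n.+1 -> R) i0 a c :
  a <= f i0 -> (forall i, i != i0 -> c <= f i) -> a + n%:R * c <= \sum_i f i.
Proof.
move=> fa fc; rewrite (bigD1 i0)//= lerD// mulr_natl.
have <- : \sum_(i | i != i0) c = c *+ n.
  by rewrite sumr_const cardC1 card_ord.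
exact: ler_sum.
Qed.

(** * Minimizers of positive definite quadratics *)

Section Quadratic.
Variables (R : realType) (n : nat).
Implicit Types (Q : 'M[R]_n) (q xs h : 'cV[R]_n).

Lemma quadD Q q xs h t : Q^T = Q -> quad Q q (xs + t *: h) =
  quad Q q xs + t * (h^T *m (Q *m xs - q)) 0 0 + t ^+ 2 / 2 * (h^T *m Q *m h) 0 0.
Proof.
move=> Qsym; rewrite /quad.
have tr11 (M : 'M[R]_1) : M^T = M by apply/matrixP => i j; rewrite mxE !ord1.
have xQh : xs^T *m Q *m h = h^T *m Q *m xs.
  by rewrite -[LHS]tr11 !trmx_mul trmxK Qsym mulmxA.
have qh : q^T *m h = h^T *m q by rewrite -[LHS]tr11 trmx_mul trmxK.
have -> : (xs + t *: h)^T = xs^T + t *: h^T by rewrite linearD linearZ.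
rewrite !(mulmxDl, mulmxDr, mulmxN, =^~ scalemxAl, =^~ scalemxAr).
rewrite !mulmxA xQh qh.
move: (xs^T *m Q *m xs) (h^T *m Q *m xs) (h^T *m Q *m h) (q^T *m xs) (h^T *m q).
by move=> A B C D E; rewrite !mxE; field.
Qed.

Lemma minimizer_stationary Q q xs : Q^T = Q ->
  (forall v : 'cV[R]_n, v != 0 -> 0 < (v^T *m Q *m v) 0 0) ->
  is_minimizer Q q xs -> Q *m xs = q.
Proof.
move=> Qsym Qpos mini; apply/eqP; rewrite -subr_eq0; apply/negPn/negP => g0.
set v := Q *m xs - q in g0.
have B0 := Qpos _ g0.
have A0 : 0 < (v^T *m v) 0 0.
  have [i vi0] := cV0Pn _ g0.
  rewrite mxE (bigD1 i)//= mxE ltr_pwDl ?sumr_ge0//.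
    by rewrite -expr2 exprn_even_gt0.
  by move=> j _; rewrite mxE -expr2 sqr_ge0.
(* Exact line search along the negative gradient, which would lower the value by
   [A ^+ 2 / B / 2]. *)
have := mini (xs + (- ((v^T *m v) 0 0 / (v^T *m Q *m v) 0 0)) *: v).
rewrite quadD// -/v.
move: ((v^T *m v) 0 0) ((v^T *m Q *m v) 0 0) A0 B0 => A B A0 B0.
have -> : quad Q q xs + - (A / B) * A + (- (A / B)) ^+ 2 / 2 * B =
   quad Q q xs - A ^+ 2 / B / 2 by field; rewrite gt_eqF.
have : 0 < A ^+ 2 / B by rewrite divr_gt0 ?exprn_gt0.
by lra.
Qed.

End Quadratic.

(** The test matrix for [J_max]: one eigenvalue [L], all others [m]. In dimension one both extremes
    are the same eigenvalue, hence [m = L]. *)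
Lemma in_QmL_diag (R : realType) n (m L : R) : 0 < m -> m <= L ->
  (0 < n)%N \/ m = L ->
  in_QmL m L (diag_mx (\row_(i < n.+1) if i == ord0 then L else m)).
Proof.
move=> m0 mL nmL; set D := \row_i _.
have Dm i : m <= D 0 i by rewrite mxE; case: ifP.
have DL i : D 0 i <= L by rewrite mxE; case: ifP.
split; first exact: tr_diag_mx.
- move=> v v0; have [j vj0] := cV0Pn _ v0.
  have vE i : (v^T *m diag_mx D) 0 i * v i 0 = D 0 i * v i 0 ^+ 2.
    by rewrite mul_mx_diag !mxE; ring.
  rewrite mxE (bigD1 j)//= vE ltr_pwDl ?sumr_ge0//.
    by rewrite mulr_gt0 ?exprn_even_gt0// (lt_le_trans m0).
  by move=> i _; rewrite vE mulr_ge0 ?sqr_ge0// (le_trans (ltW m0)).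
- split; last by move=> l /eigenvalue_diag_mx [j <-].
  by apply/eigenvalue_diag_mx; exists ord0; rewrite mxE.
- split; last by move=> l /eigenvalue_diag_mx [j <-].
  apply/eigenvalue_diag_mx; exists ord_max; rewrite mxE.
  case: nmL => [n0|->]; last by case: ifP.
  by case: n n0 {D Dm DL}.
Qed.

(** Every root of the modal polynomial at [l] is an eigenvalue of the state matrix, hence lies in
    the disc of radius [rho]. *)
Lemma converges_linearly_rho_triangle (R : realType) n (m L alpha beta gamma rho : R)
    (Q : 'M[R]_n) l : 0 <= rho -> converges_linearly n m L alpha beta gamma rho ->
  in_QmL m L Q -> eigenvalue Q l ->
  rho_triangle rho (root_sum alpha beta gamma l) (root_prod alpha beta gamma l).
Proof.
move=> rho0 conv /conv rad Ql; apply: roots_in_disc_rho_triangle => // z zE.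
exact: rad (eigenvalue_momentum_matrix Ql zE).
Qed.

(** * From single modes to the extremes over the class *)

Section NoiseAmplification.
Variables (R : realType) (n : nat) (m L alpha beta gamma rho sigw : R).
Context {d : measure_display} {Omega : measurableType d} (P : probability Omega R).
Variables (w : nat -> Omega -> 'cV[R]_n.+1) (x0 x1 : 'cV[R]_n.+1).
Hypotheses (m0 : 0 < m) (mL : m <= L) (nmL : (0 < n)%N \/ m = L).
Hypotheses (rho01 : 0 < rho < 1).
Hypothesis conv : converges_linearly n.+1 m L alpha beta gamma rho.
Hypothesis wn : white_noise P w.

Local Notation g l := (gain (root_sum alpha beta gamma l) (root_prod alpha beta gamma l)).
Local Notation tri l :=
  (rho_triangle rho (root_sum alpha beta gamma l) (root_prod alpha beta gamma l)).
Local Notation amp := (noise_amp P w x0 x1 alpha beta gamma sigw).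
Local Notation Ts := (1 - rho)^-1.

Let rho0 : 0 <= rho. Proof. by case/andP: rho01 => /ltW. Qed.

Let Ts0 : 0 < Ts. Proof. by case/andP: rho01 => _; rewrite invr_gt0 subr_gt0. Qed.

(** The diagonal test matrix belongs to the class and has both eigenvalues, so the convergence
    hypothesis applies to it. *)
Lemma rho_triangle_extreme l : l = m \/ l = L -> tri l.
Proof.
have QD := in_QmL_diag m0 mL nmL; have [_ _ [QL _] [Qm _]] := QD.
by case=> ->; apply: converges_linearly_rho_triangle QD _.
Qed.

Lemma J_max_ge b :
  b <= sigw ^+ 2 * \sum_(i < n.+1) g (if i == ord0 then L else m) * Ts ->
  (b%:E <= J_max P w x0 x1 m L alpha beta gamma sigw * Ts%:E)%E.
Proof.
move=> bg; have QD := in_QmL_diag m0 mL nmL; set D := \row_i _ in QD.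
have [Dsym Dpos _ _] := QD.
have ampE : amp (diag_mx D) 0 0 = (sigw ^+ 2 * \sum_i g (D 0 i))%:E.
  apply: (@noise_ampE _ _ _ _ _ _ _ 0 0 (fun i => D 0 i)) => //.
  - by rewrite mulmx0.
  - move=> p; rewrite horner_mx_diag mxtrace_diag.
    by apply: eq_bigr => i _; rewrite mxE.
  - move=> i; apply: rho_triangle_stable rho01 _; apply: rho_triangle_extreme.
    by rewrite mxE; case: ifP; [right|left].
apply: (@le_trans _ _ (amp (diag_mx D) 0 0 * Ts%:E)%E).
  rewrite ampE -EFinM lee_fin (le_trans bg)// -[leRHS]mulrA mulr_suml.
  by rewrite (eq_bigr (fun i => g (D 0 i) * Ts))// => i _; rewrite mxE.
apply: lee_wpmul2r; first by rewrite lee_fin ltW.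
(* With [q = 0] the minimizer is [0] by positive definiteness. *)
apply: ereal_sup_ubound; exists (diag_mx D), 0, 0; split => // y.
have quadE z : quad (diag_mx D) 0 z = 2^-1 * (z^T *m diag_mx D *m z) 0 0.
  by rewrite /quad trmx0 mul0mx [X in _ - X]mxE subr0.
rewrite !quadE trmx0 !mul0mx [X in _ * X <= _]mxE mulr0.
have [->|/Dpos yD] := eqVneq y 0; first by rewrite trmx0 !mul0mx mxE mulr0.
by rewrite mulr_ge0// ltW.
Qed.

(** Every member of the class has [m] in its spectrum and all its modes in the triangle, so a bound
    valid for all such spectra passes to the infimum. *)
Lemma J_min_ge b :
  (forall lam : 'I_n.+1 -> R, (exists i, lam i = m) ->
     (forall i, 0 < lam i <= L /\ tri (lam i)) ->
     b <= sigw ^+ 2 * \sum_i g (lam i) * Ts) ->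
  (b%:E <= J_min P w x0 x1 m L alpha beta gamma sigw * Ts%:E)%E.
Proof.
move=> bg; rewrite -lee_pdivrMr// -EFinM; apply: le_ereal_inf_tmp.
move=> _ [Q [q [xs [QmL mini ->]]]].
have [Qsym Qpos [_ QleL] [Qm Qgem]] := QmL.
have [lam [lamE Qtr]] := horner_mx_trace_sym Qsym.
have Qlam i : eigenvalue Q (lam i) by apply/lamE; exists i.
have lamtri i : tri (lam i) by exact: converges_linearly_rho_triangle conv QmL _.
rewrite (@noise_ampE _ _ _ _ _ _ _ q xs lam Qsym _ Qtr)//; last 2 first.
- exact: minimizer_stationary.
- by move=> i; apply: rho_triangle_stable rho01 _.
rewrite lee_fin ler_pdivrMr// -[leRHS]mulrA mulr_suml; apply: bg; first exact/lamE.
move=> i; split => //.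
by rewrite QleL// andbT (lt_le_trans m0)// Qgem.
Qed.

End NoiseAmplification.

Theorem theorem2 (R : realType) (n : nat) (m L alpha beta gamma rho sigma sigw : R)
  (d : measure_display) (Omega : measurableType d) (P : probability Omega R)
  (w : nat -> Omega -> 'cV[R]_n) (x0 x1 : 'cV[R]_n) :
  (0 < n)%N -> 0 < m -> m <= L ->
  ((1 < n)%N \/ m = L) ->
  0 < rho < 1 ->
  converges_linearly n m L alpha beta gamma rho ->
  0 < sigma -> (sigw = sigma \/ sigw = alpha * sigma) ->
  white_noise P w ->
  let kappa := L / m in
  let Ts := (1 - rho)^-1 in
  let Jmax := J_max P w x0 x1 m L alpha beta gamma sigw in
  let Jmin := J_min P w x0 x1 m L alpha beta gamma sigw in
  let b1 := sigw ^+ 2 * ((n.-1)%:R * (kappa ^+ 2 / 64) + (Num.sqrt kappa + 1) / 2) in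
  let b2 := sigw ^+ 2 * (kappa ^+ 2 / 64 + (n.-1)%:R * ((Num.sqrt kappa + 1) / 2)) in
  let b3 := sigma ^+ 2 / L ^+ 2 *
              ((n.-1)%:R * (kappa ^+ 2 / 4) + Num.max (kappa ^+ 2 / Ts ^+ 3) (4^-1)) in
  let b4 := sigma ^+ 2 / L ^+ 2 *
              (kappa ^+ 2 / 4 + (n.-1)%:R * Num.max (kappa ^+ 2 / Ts ^+ 3) (4^-1)) in
  [/\ (b1%:E <= Jmax * Ts%:E)%E,
      (b2%:E <= Jmin * Ts%:E)%E &
      sigw = alpha * sigma ->
        (b3%:E <= Jmax * Ts%:E)%E /\ (b4%:E <= Jmin * Ts%:E)%E].
Proof.
case: n w x0 x1 => // n w x0 x1 _ m0 mL nmL rho01 conv sigma0 _ wn.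
move=> kappa Ts Jmax Jmin b1 b2 b3 b4.
have {}nmL : (0 < n)%N \/ m = L by case: nmL; [left|right].
have triE := rho_triangle_extreme m0 mL nmL rho01 conv.
have triL : rho_triangle _ _ _ := triE L (or_intror erefl).
have L0 : 0 < L by exact: lt_le_trans mL.
split.
- apply: J_max_ge => //; rewrite /b1 ler_wpM2l ?sqr_ge0// addrC.
  (* The single mode at [L] gives the square-root term; each of the others, at [m], gives the term
     in [kappa ^+ 2]. *)
  apply: (sum_ge_split (i0 := ord0)) => [|i /negPf ->].
    by rewrite eqxx; apply: mode_bound_iterate.
  exact: mode_bound_iterate_m.
- apply: J_min_ge => // lam [i0 lami0] lamP; rewrite /b2 ler_wpM2l ?sqr_ge0//.
  (* Now one mode at [m] gives the term in [kappa ^+ 2], and the others the bound valid for every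
     mode. *)
  apply: (sum_ge_split (i0 := i0)) => [|i _].
    by rewrite lami0; apply: mode_bound_iterate_m.
  by apply: mode_bound_iterate => //; have [] := lamP i.
move=> sigwE.
(* For gradient noise, the [alpha ^+ 2] inside [sigw ^+ 2] is handed to the mode bounds and
   [sigma ^+ 2] factors out. *)
have scale X Y : L ^- 2 * X <= alpha ^+ 2 * Y ->
    sigma ^+ 2 / L ^+ 2 * X <= sigw ^+ 2 * Y.
  move=> XY; rewrite sigwE -[leLHS]mulrA.
  have -> : (alpha * sigma) ^+ 2 * Y = sigma ^+ 2 * (alpha ^+ 2 * Y) by ring.
  by apply: ler_wpM2l; rewrite ?sqr_ge0.
split.
- apply: J_max_ge => //; apply: scale.
  rewrite addrC mulrDr [L ^- 2 * (_%:R * _)]mulrCA mulr_sumr.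
  apply: (sum_ge_split (i0 := ord0)) => [|i /negPf ->].
    by rewrite eqxx; apply: mode_bound_gradient_max => //; rewrite L0 lexx.
  exact: mode_bound_gradient_m.
- apply: J_min_ge => // lam [i0 lami0] lamP; apply: scale.
  rewrite mulrDr [L ^- 2 * (_%:R * _)]mulrCA mulr_sumr.
  apply: (sum_ge_split (i0 := i0)) => [|i _].
    by rewrite lami0; apply: mode_bound_gradient_m.
  by have [? ?] := lamP i; apply: mode_bound_gradient_max.
Qed.
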